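(* Let $r\ge 1$ be real and set $\eta=(r+2,0,0)$, $\gamma=(r+1,1,0)$, $\mu=(r,1,1)$. Then, with all partitions below being weakly decreasing triples of nonnegative real numbers of total sum $r+2$: (i) there is no partition $\eta'$ with $\eta\succ\eta'\succ\gamma$ such that $J_{\eta'}(x,y,z)+J_\mu(x,y,z)\ge 2J_\gamma(x,y,z)$ for all $x,y,z>0$; (ii) there is no partition $\gamma'$ with $\eta\succ\gamma'\succ\gamma$ (so that $\eta\succ\gamma'\succ\mu$) such that $J_\eta(x,y,z)+J_\mu(x,y,z)\ge 2J_{\gamma'}(x,y,z)$ for all $x,y,z>0$; (iii) there is no partition $\mu'$ with $\mu\succ\mu'$ (so that $\gamma\succ\mu'$) such that $J_\eta(x,y,z)+J_{\mu'}(x,y,z)\ge 2J_\gamma(x,y,z)$ for all $x,y,z>0$.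
   Context: For a triple $\xi=(\xi_1,\xi_2,\xi_3)$ of nonnegative reals and positive reals $x_1,x_2,x_3$, the labeled orbit sum is $J_\xi(x_1,x_2,x_3)=\sum_{\sigma\in S_3}\prod_{i=1}^3 x_i^{\xi_{\sigma(i)}}$ (all six permutations are counted). For weakly decreasing triples $a,b$ with the same total sum, $a\succcurlyeq b$ means $a_1\ge b_1$ and $a_1+a_2\ge b_1+b_2$; $a\succ b$ means $a\succcurlyeq b$ and $a\ne b$. The classical Schur inequality is $J_\eta+J_\mu\ge 2J_\gamma$ on positive triples. *)

(* Defs.v *)
From HB Require Import structures.
From mathcomp Require Import all_boot all_order all_algebra all_fingroup.
From mathcomp Require Import all_classical all_reals all_analysis.

Set Implicit Arguments.
Unset Strict Implicit.
Unset Printing Implicit Defensive.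

Import Order.TTheory GRing.Theory Num.Theory.

Local Open Scope ring_scope.

Definition orbit_sum (R : realType) (xi x : 3.-tuple R) : R :=
  \sum_(s : 'S_3) \prod_(i < 3) tnth x i `^ tnth xi (s i).

Definition real_partition (R : realType) (n : R) (a : 3.-tuple R) : Prop :=
  [/\ sorted >=%R a, forall i : 'I_3, 0 <= tnth a i
    & \sum_(i < 3) tnth a i = n].

(* Meaningful only between weakly decreasing triples with the same total sum:
   equality of the third partial sums is not part of the relation. *)
Definition majorizes (R : realType) (a b : 3.-tuple R) : Prop :=
  b`_0 <= a`_0 /\ b`_0 + b`_1 <= a`_0 + a`_1.

Definition strictly_majorizes (R : realType) (a b : 3.-tuple R) : Prop :=
  majorizes a b /\ a <> b.

Definition schur_type (R : realType) (eta gamma mu : 3.-tuple R) : Prop :=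
  forall x y z : R, 0 < x -> 0 < y -> 0 < z ->
    orbit_sum eta [tuple x; y; z] + orbit_sum mu [tuple x; y; z]
      >= 2 * orbit_sum gamma [tuple x; y; z].

(* Main.v *)
(* Evaluate everything at (1, 1, z): there J_xi is 2 (z^xi1 + z^xi2 + z^xi3), and
   each proposed refinement is refuted by comparing the smallest exponents as
   z -> 0. In (i) and (ii) the replaced partition is (r + 2 - t, t, 0) with
   0 < t < 1: in (i) the constant terms 1 < 2 decide, in (ii) the term 2 z^t
   beats every O(z) term. In (iii) mu' has its two largest parts above 1, so that
   J_mu' contributes at most z + o(z) against 2 z. *)
Require Import Defs.
From HB Require Import structures.
From mathcomp Require Import all_boot all_order all_algebra all_fingroup.
From mathcomp Require Import all_classical all_reals all_analysis.
From mathcomp Require Import lra.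

Set Implicit Arguments.
Unset Strict Implicit.
Unset Printing Implicit Defensive.

Import Order.TTheory GRing.Theory Num.Theory.

Local Open Scope ring_scope.

(** Composing with a transposition shows that the sum is the same for every [i]; summed over all
    [i], each [s] merely reorders [\sum_j f j]. *)
Lemma sum_perm_apply (V : zmodType) (n : nat) (f : 'I_n -> V) (i : 'I_n) :
  (\sum_(s : 'S_n) f (s i)) *+ n = (\sum_j f j) *+ n`!.
Proof.
have shift k : \sum_(s : 'S_n) f (s k) = \sum_(s : 'S_n) f (s i).
  rewrite (reindex_inj (mulgI (tperm i k))) /=.
  by apply: eq_bigr => s _; rewrite permM tpermR.
transitivity (\sum_(k < n) \sum_(s : 'S_n) f (s k)).
  by rewrite (eq_bigr _ (fun k _ => shift k)) sumr_const card_ord.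
rewrite exchange_big (eq_bigr (fun=> \sum_j f j)) ?sumr_const ?card_Sn // => s _.
by rewrite [RHS](reindex_inj (@perm_inj _ s)).
Qed.

Lemma orbit_sum_11z (R : realType) (a b c z : R) :
  orbit_sum [tuple a; b; c] [tuple 1; 1; z] = 2 * (z `^ a + z `^ b + z `^ c).
Proof.
rewrite /orbit_sum.
under eq_bigr => s _ do rewrite !big_ord_recr big_ord0 /= !(tnth_nth 0) /= !powR1 !mul1r.
have := sum_perm_apply (fun j : 'I_3 => z `^ [:: a; b; c]`_j) ord_max.
rewrite !big_ord_recr big_ord0 /= add0r.
rewrite (_ : 3`! = 6)%N //; lra.
Qed.

Lemma real_partition3P (R : realType) (n : R) (t : 3.-tuple R) :
  real_partition n t -> exists a b c : R,
    t = [tuple a; b; c] /\ [/\ b <= a, c <= b, 0 <= c & a + b + c = n].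
Proof.
case/tupleP: t => a t; case/tupleP: t => b t; case/tupleP: t => c t.
rewrite [t]tuple0 => -[/= /and3P[ba cb _] ge0 sum].
exists a, b, c; split; first exact: val_inj.
split=> //; first by have := ge0 ord_max; rewrite (tnth_nth 0).
by move: sum; rewrite !big_ord_recr big_ord0 /= !(tnth_nth 0) /= add0r.
Qed.

(** Majorizing [(r + 1, 1, 0)] puts the whole total into the first two parts, so one parameter
    remains; strictness excludes its two endpoints. *)
Lemma partition_between (R : realType) (r : R) (t : 3.-tuple R) :
  real_partition (r + 2) t ->
  strictly_majorizes [tuple r + 2; 0; 0] t ->
  strictly_majorizes t [tuple r + 1; 1; 0] ->
  exists2 u : R, 0 < u < 1 & t = [tuple r + 2 - u; u; 0].
Proof.
move=> /real_partition3P[a [b [c [-> [ba cb c0 sum]]]]].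
move=> [[/= h1 h2] ne1] [[/= h3 h4] ne2].
have c_eq : c = 0 by lra.
have a_eq : a = r + 2 - b by lra.
subst a c; exists b => //; apply/andP; split; rewrite lt_neqAle; apply/andP; split.
- by apply/eqP => b0; apply: ne1; rewrite -b0 subr0.
- by [].
- by apply/eqP => b1; apply: ne2; rewrite b1; congr [tuple _; _; _]; lra.
- by lra.
Qed.

(** Replaces the limit at 0 by one explicit [z], chosen to fix the ratio of two competing powers;
    [z <= 1] makes powers decrease in the exponent. *)
Lemma exists_powR_eq (R : realType) (p q : R) : 0 < p -> 0 < q -> q < 1 ->
  exists2 z : R, 0 < z <= 1 & z `^ p = q.
Proof.
move=> p0 q0 q1; exists (q `^ p^-1).
  rewrite powR_gt0 //= [leRHS](_ : 1 = 1 `^ p^-1); last by rewrite powR1.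
  apply: ge0_ler_powR.
  - by rewrite invr_ge0 ltW.
  - by rewrite nnegrE ltW.
  - by rewrite nnegrE.
  - exact: ltW.
by rewrite -powRrM mulVf ?gt_eqF // powRr1 // ltW.
Qed.

Theorem proposition13p2 (R : realType) (r : R) (r_ge1 : 1 <= r) :
  let eta : 3.-tuple R := [tuple r + 2; 0; 0] in
  let gamma : 3.-tuple R := [tuple r + 1; 1; 0] in
  let mu : 3.-tuple R := [tuple r; 1; 1] in
  [/\ ~ (exists eta' : 3.-tuple R,
          [/\ real_partition (r + 2) eta',
              strictly_majorizes eta eta',
              strictly_majorizes eta' gamma
            & schur_type eta' gamma mu]),
      (forall gamma' : 3.-tuple R,
          real_partition (r + 2) gamma' ->
          strictly_majorizes eta gamma' -> strictly_majorizes gamma' gamma ->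
          strictly_majorizes gamma' mu) /\
      ~ (exists gamma' : 3.-tuple R,
          [/\ real_partition (r + 2) gamma',
              strictly_majorizes eta gamma',
              strictly_majorizes gamma' gamma
            & schur_type eta gamma' mu])
    & (forall mu' : 3.-tuple R,
          real_partition (r + 2) mu' ->
          strictly_majorizes mu mu' -> strictly_majorizes gamma mu') /\
      ~ (exists mu' : 3.-tuple R,
          [/\ real_partition (r + 2) mu',
              strictly_majorizes mu mu'
            & schur_type eta gamma mu'])].
Proof.
move=> eta gamma mu; split.
- move=> [t [part et tg]]; have [u /andP[u0 u1] ->] := partition_between part et tg.
  (* All five nonconstant terms on the left have exponent at least [u], so they total at most 5/8,
     below the constant deficit 1. *)
  have [||z z01 zu] := @exists_powR_eq _ u (1 / 8) u0; try lra.
  have /andP[z0 _] := z01.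
  move=> /(_ 1 1 z ltr01 ltr01 z0); rewrite !orbit_sum_11z !powRr0 !(powRr1 (ltW z0)).
  have le_zu (p : R) : u <= p -> z `^ p <= 1 / 8 by rewrite -zu; apply: ger_powR.
  have le1 : z <= 1 / 8 by rewrite -[leLHS](powRr1 (ltW z0)); apply: le_zu; lra.
  have le2 : z `^ r <= 1 / 8 by apply: le_zu; lra.
  have le3 : z `^ (r + 2 - u) <= 1 / 8 by apply: le_zu; lra.
  by have := powR_ge0 z (r + 1); lra.
- split.
    move=> t part et tg; have [u /andP[u0 u1] ->] := partition_between part et tg.
    by split; [split=> /=; lra | case=> *; lra].
  move=> [t [part et tg]]; have [u /andP[u0 u1] ->] := partition_between part et tg.
  (* Now [z] is a quarter of [z ^ u]. The constants cancel and the left keeps at most [4 z], which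
     is [z ^ u], against [2 z ^ u]. *)
  have [|||z z01 zu] := @exists_powR_eq _ (1 - u) (1 / 4); try lra.
  have /andP[z0 _] := z01.
  move=> /(_ 1 1 z ltr01 ltr01 z0); rewrite !orbit_sum_11z !powRr0 !(powRr1 (ltW z0)).
  have z_split : z = z `^ u * (1 / 4).
    by rewrite -zu -powRD ?(gt_eqF z0) ?implybT // subrKC powRr1 // ltW.
  have le1 : z `^ (r + 2) <= z by apply: ge1r_powR => //; lra.
  by have := ge1r_powR z01 r_ge1; have := powR_ge0 z (r + 2 - u); lra.
- have mu_part t : real_partition (r + 2) t -> strictly_majorizes mu t ->
      exists a b c : R, t = [tuple a; b; c] /\
        [/\ b <= a, a <= r, a + b <= r + 1, 1 < b & 1 <= c].
    move=> /real_partition3P[a [b [c [-> [ba cb c0 sum]]]]] [[/= h1 h2] ne].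
    exists a, b, c; split=> //; split=> //; last by lra.
    (* Since [c >= 1], having [b <= 1] would force [b = c = 1] and [a = r], that is, [mu] itself. *)
    rewrite ltNge; apply/negP => b1; apply: ne.
    by congr [tuple _; _; _]; lra.
  split.
    move=> t part mt; have [a [b [c [-> [ba ar abr b1 c1]]]]] := mu_part t part mt.
    by split; [split=> /=; lra | case=> *; lra].
  move=> [t [part mt]]; have [a [b [c [-> [ba ar abr b1 c1]]]]] := mu_part t part mt.
  (* Then [z ^ b] is [z / 4], which also bounds the powers [a] and [r + 2]. With [z ^ c <= z] the
     left keeps at most [7 z / 4], less than [2 z]. *)
  have [|||z z01 zb] := @exists_powR_eq _ (b - 1) (1 / 4); try lra.
  have /andP[z0 _] := z01.
  move=> /(_ 1 1 z ltr01 ltr01 z0); rewrite !orbit_sum_11z !powRr0 !(powRr1 (ltW z0)).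
  have zbE : z `^ b = z * (1 / 4).
    by rewrite -zb mulr_powRB1 ?ltW //; lra.
  have le_zb (p : R) : b <= p -> z `^ p <= z * (1 / 4).
    by rewrite -zbE; apply: ger_powR.
  have zc : z `^ c <= z by apply: ge1r_powR.
  have le1 : z `^ (r + 2) <= z * (1 / 4) by apply: le_zb; lra.
  by have := le_zb a ba; have := powR_ge0 z (r + 1); lra.
Qed.
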